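(* Let $k\ge 1$ be an integer. Let $A_{2k}$ be the set of all positive integers whose Zeckendorf decomposition has $F_{2k}$ as its smallest summand, and let $p(j)$ denote the $j$th smallest element of $A_{2k}$ ($j\ge 1$). Then for every $j\ge 2$, $F_{2k}\in CG(p(j))$ if and only if $\mathcal{S}(j-1)=B$. Moreover, $\min CG(p(j))\ge F_{2k}$ for all $j\ge 1$.
   Context: Fibonacci numbers: $F_0=0$, $F_1=1$, $F_{n+2}=F_{n+1}+F_n$. Zeckendorf decomposition: every positive integer $n$ is uniquely a sum $\sum_{i\ge 2} a_iF_i$ with $a_i\in\{0,1\}$, finitely many nonzero, and no two consecutive $a_i,a_{i+1}$ both equal to $1$. Chung-Graham decomposition: every positive integer $n$ is uniquely a sum $\sum_{i\ge 1}c_iF_{2i}$ with $c_i\in\{0,1,2\}$, finitely many nonzero, such that whenever $c_{i_1}=c_{i_2}=2$ with $i_1<i_2$, there is $j$ with $i_1<j<i_2$ and $c_j=0$. $CG(n)$ is the set of all Fibonacci numbers appearing (with nonzero coefficient) in the Chung-Graham decomposition of $n$. Golden string: define finite strings over $\{A,B\}$ by $S_1=B$, $S_2=BA$, and $S_n=S_{n-1}:S_{n-2}$ (concatenation) for $n\ge 3$. Then $|S_n|=F_{n+1}$, each $S_n$ is a prefix of $S_{n+1}$, and $\mathcal{S}=BABBABABBABBA\ldots$ is the infinite string having every $S_n$ as a prefix; $\mathcal{S}(i)$ is its $i$th letter ($i\ge 1$). *)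

(* Defs.v *)
From mathcomp Require Import all_boot.
From mathcomp Require Import boolp classical_sets.

Set Implicit Arguments.
Unset Strict Implicit.
Unset Printing Implicit Defensive.

Local Open Scope classical_set_scope.

Fixpoint fib (n : nat) : nat :=
  match n with
  | 0 => 0
  | 1 => 1
  | (m.+1 as m1).+1 => fib m1 + fib m
  end.

(* Only the values a i with 2 <= i matter; N bounds the support. *)
Definition zeckendorf (a : nat -> nat) (n : nat) : Prop :=
  [/\ forall i, 2 <= i -> a i <= 1,
      forall i, 2 <= i -> ~ (a i = 1 /\ a i.+1 = 1)
    & exists N, (forall i, 2 <= i -> N <= i -> a i = 0) /\
                n = \sum_(2 <= i < N) a i * fib i].

(* Only the values c i with 1 <= i matter; N bounds the support. *)
Definition chung_graham (c : nat -> nat) (n : nat) : Prop :=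
  [/\ forall i, 1 <= i -> c i <= 2,
      forall i1 i2, 1 <= i1 -> i1 < i2 -> c i1 = 2 -> c i2 = 2 ->
        exists j, i1 < j < i2 /\ c j = 0
    & exists N, (forall i, 1 <= i -> N <= i -> c i = 0) /\
                n = \sum_(1 <= i < N) c i * fib (2 * i)].

(* Both decompositions are unique, so "some decomposition of n" in the next
   two definitions is "the decomposition of n". *)
Definition Zeck (n : nat) : set nat :=
  [set f | exists a, zeckendorf a n /\
           exists i, [/\ 2 <= i, a i <> 0 & f = fib i]].

Definition CG (n : nat) : set nat :=
  [set f | exists c, chung_graham c n /\
           exists i, [/\ 1 <= i, c i <> 0 & f = fib (2 * i)]].

(* The minimum of P; by convention 0 if P is empty. *)
Definition least (P : set nat) : nat :=
  xget 0 [set x | P x /\ forall y, P y -> x <= y].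

(* The j-th smallest element of P, counting from j = 1; meaningful when P has at
   least j elements. *)
Fixpoint nth_smallest (P : set nat) (j : nat) : nat :=
  match j with
  | 0 => 0
  | i.+1 => least [set x | P x /\ (1 <= i -> nth_smallest P i < x)]
  end.

(* For r > 0, fib r > 0 excludes the conventional value least set0 = 0. *)
Definition smallest_summand_set (r : nat) : set nat :=
  [set n | 0 < n /\ least (Zeck n) = fib r].

Inductive letter := letA | letB.

(* S_n for n >= 1; the value at 0 is a placeholder. *)
Fixpoint golden_prefix (n : nat) : seq letter :=
  match n with
  | 0 => [::]
  | 1 => [:: letB]
  | 2 => [:: letB; letA]
  | (m.+1 as m1).+1 => golden_prefix m1 ++ golden_prefix m
  end.

(* The i-th letter (i >= 1) of the infinite string: S_i already has at least i
   letters, and golden_prefixP shows that every S_n is a prefix. *)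
Definition golden_string (i : nat) : letter :=
  nth letA (golden_prefix i) i.-1.

Lemma golden_prefixS n :
  golden_prefix n.+3 = golden_prefix n.+2 ++ golden_prefix n.+1.
Proof. by []. Qed.

Lemma size_golden_prefix n :
  1 <= n -> size (golden_prefix n) = fib n.+1.
Proof.
suff H m : size (golden_prefix m.+1) = fib m.+2 /\
           size (golden_prefix m.+2) = fib m.+3 by case: n => // n _; case: (H n).
elim: m => [//|m [IH1 IH2]]; split=> //.
by rewrite golden_prefixS size_cat IH1 IH2.
Qed.

Lemma leq_size_golden_prefix i : i <= size (golden_prefix i).
Proof.
suff H m : (m.+1 <= size (golden_prefix m.+1)) &&
           (m.+2 <= size (golden_prefix m.+2)) by case: i => // n; case/andP: (H n).
elim: m => [//|m /andP[IH1 IH2]]; apply/andP; split=> //.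
rewrite golden_prefixS size_cat -addn1; apply: leq_add IH2 _.
exact: leq_trans IH1.
Qed.

Lemma golden_prefix_cat n d :
  1 <= n -> exists t, golden_prefix (n + d) = golden_prefix n ++ t.
Proof.
move=> n1; elim: d => [|d [t IH]]; first by exists [::]; rewrite addn0 cats0.
suff [u Hu] : exists u, golden_prefix (n + d).+1 = golden_prefix (n + d) ++ u.
  by exists (t ++ u); rewrite addnS Hu IH catA.
have : 1 <= n + d by rewrite (leq_trans n1) // leq_addr.
case: (n + d) => [//|[_|m _]]; first by exists [:: letA].
by exists (golden_prefix m.+1); rewrite golden_prefixS.
Qed.

Lemma golden_prefixP n i :
  1 <= i <= size (golden_prefix n) ->
  golden_string i = nth letA (golden_prefix n) i.-1.
Proof.
case: i => [//|i] /= lt_i; rewrite /golden_string /=.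
have n1 : 1 <= n by case: n lt_i.
have lt_i' := leq_size_golden_prefix i.+1.
have [le|/ltnW le] := leqP n i.+1.
  have [t Ht] := golden_prefix_cat (i.+1 - n) n1.
  by rewrite subnKC // in Ht; rewrite -/(golden_prefix i.+1) Ht nth_cat lt_i.
have [t Ht] := @golden_prefix_cat i.+1 (n - i.+1) isT.
by rewrite subnKC // in Ht; rewrite Ht nth_cat lt_i'.
Qed.

(* Main.v *)
(* Write j = sum a_i F_i (Zeckendorf) and j = sum c_i F_{2i} (Chung-Graham), and
   let z = sum a_i F_{i+1} and g = sum c_i F_{2i+1}. Peeling off the top summands
   shows that g - z, as a function of j, obeys the same recursion as the letters
   of the golden string: for j >= 1, g - z is 1 if S(j) = A and 0 if S(j) = B.
   The numbers q(j) = F_{2k} + sum a_i F_{i+2k} = F_{2k} (1 + z) + F_{2k-1} j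
   enumerate A_{2k} increasingly, so p(j+1) = q(j). On the other hand
   sum c_i F_{2i+2k} = F_{2k} g + F_{2k-1} j, hence
   q(j) = (1 + z - g) F_{2k} + sum c_i F_{2(i+k)}; as 1 + z - g is 0 or 1, this is
   the Chung-Graham decomposition of q(j). *)
Require Import Defs.
From mathcomp Require Import all_boot.
From mathcomp Require Import boolp classical_sets.
From mathcomp Require Import zify.

Set Implicit Arguments.
Unset Strict Implicit.
Unset Printing Implicit Defensive.

(** * Fibonacci numbers and finite sums *)

Lemma fibSS n : fib n.+2 = fib n.+1 + fib n.
Proof. by []. Qed.

Lemma fib_gt0 n : 0 < fib n.+1.
Proof. by elim: n => // n IH; rewrite fibSS; lia. Qed.

Lemma fib_leqS n : fib n <= fib n.+1.
Proof. by case: n => // n; rewrite fibSS; lia. Qed.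

Lemma leq_fib m n : m <= n -> fib m <= fib n.
Proof.
move=> /subnKC <-; elim: (n - m) => [|d IH]; first by rewrite addn0.
by rewrite addnS; apply: leq_trans IH (fib_leqS _).
Qed.

Lemma ltn_fib m n : 2 <= m -> m < n -> fib m < fib n.
Proof.
case: m => [|[|m]] // _ lt_mn; apply: leq_trans (leq_fib lt_mn).
by rewrite (fibSS m.+1); have := fib_gt0 m; lia.
Qed.

Lemma fib_inj m n : 2 <= m -> 2 <= n -> fib m = fib n -> m = n.
Proof.
move=> m2 n2 e; case: (ltngtP m n) => // lt.
  by have := ltn_fib m2 lt; lia.
by have := ltn_fib n2 lt; lia.
Qed.

Lemma fib_add n s : fib (n + s.+1) = fib n.+1 * fib s.+1 + fib n * fib s.
Proof.
suff: fib (n + s.+1) = fib n.+1 * fib s.+1 + fib n * fib s /\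
  fib (n + s.+2) = fib n.+1 * fib s.+2 + fib n * fib s.+1 by case.
elim: s => [|s [IH1 IH2]].
  split; first by rewrite addn1 /= muln1 muln0 addn0.
  by rewrite addn2 fibSS /= !muln1.
split=> //; rewrite !addnS fibSS -!addnS IH1 IH2 (fibSS s.+1) (fibSS s); lia.
Qed.

Lemma ltn_fib_add2 n : n < fib n.+2.
Proof.
by elim: n => // n IH; rewrite fibSS; have := fib_gt0 n; lia.
Qed.

Lemma fib_bracket n : 0 < n -> exists2 m, 2 <= m & fib m <= n < fib m.+1.
Proof.
move=> n0; suff H N : n < fib N.+2 ->
    exists2 m, 2 <= m & fib m <= n < fib m.+1 by exact: H (ltn_fib_add2 n).
elim: N => [/=|N IH lt_n]; first by lia.
by case: (ltnP n (fib N.+2)) => [/IH//|le]; exists N.+2 => //; rewrite le.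
Qed.

Lemma sum_nat_recr (f : nat -> nat) m n : m <= n ->
  \sum_(m <= i < n.+1) f i = \sum_(m <= i < n) f i + f n.
Proof. exact: big_nat_recr. Qed.

(** This allows decompositions with different support bounds to be compared on one range. *)
Lemma big_nat_stable (f : nat -> nat) m N N' : N <= N' ->
  (forall i, m <= i -> N <= i -> f i = 0) ->
  \sum_(m <= i < N') f i = \sum_(m <= i < N) f i.
Proof.
move=> le f0; case: (leqP m N) => mN.
  rewrite (big_cat_nat mN le) /= [X in _ + X]big_nat_cond [X in _ + X]big1 ?addn0 // => i.
  by case/andP => /andP[h1 h2] _; apply: f0 => //; apply: leq_trans h1.
rewrite [RHS]big_geq ?(ltnW mN) // big_nat_cond big1 // => i.
by case/andP => /andP[h1 h2] _; apply: f0 => //; lia.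
Qed.

(** * Increasing enumeration of a set *)

Lemma leastE (P : set nat) x : P x -> (forall y, P y -> x <= y) -> least P = x.
Proof.
move=> Px le_x; apply: xget_unique => // y [Py le_y].
by apply/eqP; rewrite eqn_leq le_x // le_y.
Qed.

(** As [f] increases strictly, the least element of [P] above [f j] is [f j.+1]; [nth_smallest]
    counts from 1 and [f] from 0. *)
Lemma nth_smallest_enum (P : set nat) (f : nat -> nat) :
  (forall i j, i < j -> f i < f j) -> (forall n, P n <-> exists j, n = f j) ->
  forall j, nth_smallest P j.+1 = f j.
Proof.
move=> f_inc PE.
have f_le i j : i <= j -> f i <= f j.
  by rewrite leq_eqVlt => /orP[/eqP->//|/f_inc/ltnW].
elim=> [|j IH].
  apply: leastE => [|_ [/PE[i ->] _]]; last exact: f_le.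
  by split=> //; apply/PE; exists 0.
have -> : nth_smallest P j.+2 =
  least [set x | P x /\ (1 <= j.+1 -> nth_smallest P j.+1 < x)]%classic by [].
rewrite IH; apply: leastE => [|_ [/PE[i ->] /(_ isT) lt_f]].
  by split=> [|_]; [apply/PE; exists j.+1 | apply: f_inc].
by apply: (f_le); case: (ltnP j i) => // /f_le; lia.
Qed.

(** * Zeckendorf digits: size, uniqueness, existence *)

Definition zeck_digits (a : nat -> nat) : Prop :=
  (forall i, 2 <= i -> a i <= 1) /\
  (forall i, 2 <= i -> ~ (a i = 1 /\ a i.+1 = 1)).

(** A top digit 1 at N forces the digit 0 at N-1, so the rest is below F_{N-1}; the induction
    therefore carries two consecutive bounds. *)
Lemma zeck_sum_lt a N : zeck_digits a ->
  \sum_(2 <= i < N.+1) a i * fib i < fib N.+1.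
Proof.
move=> [a1 a2].
suff: \sum_(2 <= i < N.+1) a i * fib i < fib N.+1 /\
  \sum_(2 <= i < N.+2) a i * fib i < fib N.+2 by case.
elim: N => [|N [IH1 IH2]]; first by rewrite !big_geq.
split=> //; rewrite sum_nat_recr // (fibSS N.+1).
have := a1 N.+2 isT; case aE: (a N.+2) => [|[|//]] _; first by lia.
case: N IH1 IH2 aE => [|N] IH1 IH2 aE; first by rewrite big_geq //=; lia.
have a0 : a N.+2 = 0.
  by have := a1 N.+2 isT; case E: (a N.+2) => [|[|//]] // _; case: (a2 N.+2).
by rewrite sum_nat_recr // a0; lia.
Qed.

(** By [zeck_sum_lt] the digits below a top index N sum to less than F_N, so the sum decides the top
    digit. *)
Lemma zeck_digits_uniq a b N : zeck_digits a -> zeck_digits b ->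
  \sum_(2 <= i < N) a i * fib i = \sum_(2 <= i < N) b i * fib i ->
  forall i, 2 <= i < N -> a i = b i.
Proof.
move=> za zb; elim: N => [|N IH]; first by lia.
case: (leqP 2 N) => [N2|]; last by lia.
rewrite !sum_nat_recr //.
have := zeck_sum_lt N.-1 za; have := zeck_sum_lt N.-1 zb.
rewrite prednK; last by lia.
move=> ub ua e i.
have ab : a N = b N.
  have := za.1 N N2; have := zb.1 N N2.
  by case: (a N) e => [|[|//]]; case: (b N) => [|[|//]]; lia.
case: (eqVneq i N) => [->//|ne] lt_i; apply: IH; last by lia.
by move: e; rewrite ab; lia.
Qed.

Lemma zeckendorf_uniq a b n : zeckendorf a n -> zeckendorf b n ->
  forall i, 2 <= i -> a i = b i.
Proof.
move=> [a1 a2 [N [aN an]]] [b1 b2 [M [bM bn]]] i i2.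
pose L := maxn i.+1 (maxn N M).
apply: (@zeck_digits_uniq a b L) => //; last by rewrite /L; lia.
rewrite (@big_nat_stable _ 2 N); first last.
- by move=> j j2 jN; rewrite aN.
- by rewrite /L; lia.
rewrite -an [RHS](@big_nat_stable _ 2 M) //; first by rewrite /L; lia.
by move=> j j2 jM; rewrite bM.
Qed.

Lemma zeckendorf_exists n : exists a, zeckendorf a n.
Proof.
suff H N : forall n, n < fib N.+2 -> exists a, [/\ zeck_digits a,
    forall i, N.+2 <= i -> a i = 0 & n = \sum_(2 <= i < N.+2) a i * fib i].
  have [a [[a1 a2] a0 ->]] := H n n (ltn_fib_add2 n).
  by exists a; split=> //; exists n.+2; split=> // i _; apply: a0.
elim/ltn_ind: N => -[_ {}n lt_n|N IH {}n lt_n].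
  exists (fun=> 0); split=> //; first by split=> // i _ [].
  by rewrite big_geq //; move: lt_n => /=; lia.
case: (ltnP n (fib N.+2)) => [/(IH N (ltnSn _))[a [za a0 ->]]|le].
  exists a; split=> // [i lt_i|]; first by apply: a0; lia.
  by rewrite [RHS]sum_nat_recr // a0 // addn0.
(* The remainder is below F_{N+1}, so its digits can vanish from index N+1 on, and the new digit 1
   at N+2 gets no neighbour. *)
suff [a [[a1 a2] a0 an]] : exists a, [/\ zeck_digits a,
    forall i, N.+1 <= i -> a i = 0 &
    n - fib N.+2 = \sum_(2 <= i < N.+2) a i * fib i].
  exists (fun i => if i == N.+2 then 1 else a i); split.
  - split=> i i2; first by case: ifP => // _; apply: a1.
    move=> [ai aiS]; apply: (a2 i i2); move: ai aiS.
    case: eqP => [->|_]; first by rewrite (a0 N.+3); [case: eqP => //; lia|lia].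
    by case: eqP => [[->]|//]; rewrite a0.
  - by move=> i lt_i; case: eqP => [|_]; [lia | apply: a0; lia].
  - rewrite sum_nat_recr // eqxx mul1n -[LHS](subnK le) an; congr (_ + _).
    by apply: eq_big_nat => i lt_i; case: eqP => //; lia.
case: N IH lt_n le => [|N] IH lt_n le.
  exists (fun=> 0); split=> //; first by split=> // i _ [].
  by rewrite big_geq //; move: lt_n => /=; lia.
have [|a [za a0 an]] := IH N (leqnSn _) (n - fib N.+3).
  by move: lt_n; rewrite (fibSS N.+2); lia.
by exists a; split=> //; rewrite an [RHS]sum_nat_recr // a0 // addn0.
Qed.

(** * Shifting Zeckendorf indices by one *)

(** Greedy expansion over F_{N+1}, ..., F_2; [N] counts the candidates left. *)
Fixpoint zeck_shift_upto (N n : nat) : nat :=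
  if N is N'.+1 then
    if fib N'.+2 <= n then fib N'.+3 + zeck_shift_upto N' (n - fib N'.+2)
    else zeck_shift_upto N' n
  else 0.

(* The number z of the header, computed greedily; [n] is enough fuel. *)
Definition zeck_shift n := zeck_shift_upto n n.

Lemma zeck_shift_uptoS N n : zeck_shift_upto N.+1 n =
  if fib N.+2 <= n then fib N.+3 + zeck_shift_upto N (n - fib N.+2)
  else zeck_shift_upto N n.
Proof. by []. Qed.

(** Candidates exceeding [n] are skipped, so every sufficiently high starting level gives the same
    value. *)
Lemma zeck_shift_uptoE N n : n < fib N.+2 -> zeck_shift_upto N n = zeck_shift n.
Proof.
have step M : n < fib M.+2 -> zeck_shift_upto M.+1 n = zeck_shift_upto M n.
  by move=> lt_n; rewrite zeck_shift_uptoS leqNgt lt_n.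
have steps M d : n < fib M.+2 -> zeck_shift_upto (M + d) n = zeck_shift_upto M n.
  move=> lt_n; elim: d => [|d IH]; first by rewrite addn0.
  rewrite addnS step //; apply: leq_trans lt_n (leq_fib _); lia.
move=> lt_n; rewrite /zeck_shift; case: (leqP N n) => le.
  by rewrite -(steps N (n - N) lt_n) subnKC.
by rewrite -(steps n (N - n) (ltn_fib_add2 n)) subnKC // ltnW.
Qed.

Lemma zeck_shift_rec m n : 2 <= m -> fib m <= n < fib m.+1 ->
  zeck_shift n = fib m.+1 + zeck_shift (n - fib m).
Proof.
case: m => [|[|m]] // _ /andP[le lt].
rewrite -(@zeck_shift_uptoE m.+1) // zeck_shift_uptoS le zeck_shift_uptoE //.
by move: lt; rewrite (fibSS m.+1); have := fib_leqS m.+1; lia.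
Qed.

(** By [zeck_sum_lt], a top digit 1 at N puts the sum between F_N and F_{N+1}, so the greedy
    recursion peels off exactly this digit. *)
Lemma zeck_shift_sum a N : zeck_digits a ->
  zeck_shift (\sum_(2 <= i < N) a i * fib i) =
  \sum_(2 <= i < N) a i * fib i.+1.
Proof.
move=> za; elim: N => [|N IH]; first by rewrite !big_geq.
case: (leqP 2 N) => N2; last by rewrite !big_geq.
rewrite !sum_nat_recr //.
have := zeck_sum_lt N za; rewrite sum_nat_recr //.
have := za.1 N N2; case: (a N) => [|[|//]] _ lt; first by rewrite !addn0.
rewrite (@zeck_shift_rec N) //; last by lia.
by rewrite mul1n addnK IH addnC mul1n.
Qed.

(** Moving the digits up one index, as [b] does, keeps them Zeckendorf digits, so [zeck_sum_lt] also
    bounds the shifted sum. *)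
Lemma zeck_shift_lt m n : n < fib m.+2 -> zeck_shift n < fib m.+3.
Proof.
have [a [a1 a2 [N [aN ->]]]] := zeckendorf_exists n.
have za : zeck_digits a by [].
move=> lt_n; rewrite zeck_shift_sum //.
pose b i := if i is i'.+1 then if 2 <= i' then a i' else 0 else 0.
have zb : zeck_digits b.
  split=> [[//|i] _ /=|[//|i] _ /=]; first by case: ifP => // /a1.
  case: ifP => [i2|_ []//]; rewrite (leqW i2); exact: a2.
have aE i : 2 <= i -> m.+2 <= i -> a i = 0.
  move=> i2 mi; case: (ltnP i N) => [iN|]; last exact: aN.
  case ai: (a i) => [//|d].
  suff: fib i <= \sum_(2 <= i < N) a i * fib i by have := leq_fib mi; lia.
  by rewrite (big_cat_nat i2 (ltnW iN)) /= [X in _ + X]big_ltn // ai mulSn; lia.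
rewrite -(@big_nat_stable _ 2 N (maxn N m.+2)); first last.
- by move=> i i2 iN; rewrite aN.
- by lia.
rewrite (@big_nat_stable _ 2 m.+2); first last.
- by move=> i i2 im; rewrite aE.
- by lia.
apply: leq_ltn_trans (zeck_sum_lt m.+2 zb).
rewrite [leqRHS]big_ltn // [X in _ + X]big_add1 /=.
by rewrite mul0n add0n; apply: eq_leq; apply: eq_big_nat => i /andP[-> _].
Qed.

(** Let F_r <= n < F_{r+1}. If m < F_r, then F_{r+1} separates the two values; otherwise F_r is
    peeled off both arguments. *)
Lemma zeck_shift_mono m n : m <= n -> zeck_shift m <= zeck_shift n.
Proof.
elim/ltn_ind: n m => n IH m le_mn.
case: (posnP n) => [n0|n0]; first by have -> : m = n by lia.
have [r r2 br] := fib_bracket n0; rewrite (zeck_shift_rec r2 br).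
case: (ltnP m (fib r)) => lt.
  case: r r2 br lt => [|[|[|r]]] // _ br lt; last by have := zeck_shift_lt lt; lia.
  by have -> : m = 0 by move: lt => /=; lia.
rewrite (@zeck_shift_rec r m) //; last by lia.
rewrite leq_add2l; apply: IH; last by lia.
by have := @leq_fib 2 r r2; rewrite /=; lia.
Qed.

(** * Self-similarity of the golden string *)

(* The value 0 at [j = 0] makes [cg_shift 0 = 0]. *)
Definition goldenA (j : nat) : nat :=
  if j is 0 then 0 else if golden_string j is letA then 1 else 0.

(** S_m is S_{m-1} followed by S_{m-2}, and S_{m-1} has length F_m, so the positions after F_m read
    S_{m-2}. *)
Lemma golden_string_rec m j : 3 <= m -> fib m < j <= fib m.+1 ->
  golden_string j = golden_string (j - fib m).
Proof.
case: m => [|[|[|m]]] // _ /andP[lt le].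
rewrite (@golden_prefixP m.+3); last by rewrite size_golden_prefix //; lia.
rewrite golden_prefixS nth_cat size_golden_prefix // ifN; last by lia.
rewrite [RHS](@golden_prefixP m.+1).
  by congr (nth _ _ _); lia.
by rewrite size_golden_prefix //; move: le; rewrite (fibSS m.+2); lia.
Qed.

(** Position F_m holds the last letter of S_{m-1}, and these last letters alternate between B and
    A. *)
Lemma goldenA_fib m : 2 <= m -> goldenA (fib m) = odd m.
Proof.
suff H n : golden_string (fib n.+2) = (if odd n then letA else letB) /\
    golden_string (fib n.+3) = (if odd n then letB else letA).
  case: m => [|[|m]] // _; have := (H m).1; have := fib_gt0 m.+1.
  by rewrite /goldenA; case: (fib m.+2) => // f _ -> /=; rewrite negbK; case: odd.
elim: n => // n [IH1 IH2]; split; first by rewrite IH2 /=; case: odd.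
rewrite (@golden_string_rec n.+3) //.
  rewrite (fibSS n.+2).
  by rewrite addKn IH1 /=; case: odd.
by rewrite (fibSS n.+2); have := fib_gt0 n.+1; lia.
Qed.

Lemma goldenA_rec m j : 2 <= m -> fib m < j < fib m.+1 ->
  goldenA j = goldenA (j - fib m).
Proof.
case: m => [|[|[|m]]] // _ lt; first by move: lt => /=; lia.
rewrite /goldenA (@golden_string_rec m.+3) //; last by lia.
by case: j lt => [|j] lt; [lia | case E: (j.+1 - _) => //; lia].
Qed.

(** * Recursion for the Chung-Graham shift *)

(* The number g of the header, by [cg_shift_sum] below. *)
Definition cg_shift n := zeck_shift n + goldenA n.

(** The correction belongs to remainder 0: [goldenA 0] is 0 by convention, whereas the letter at F_m
    is A for odd m. *)
Lemma cg_shift_rec m n : 2 <= m -> fib m <= n < fib m.+1 ->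
  cg_shift n = fib m.+1 + cg_shift (n - fib m) + (n == fib m) * odd m.
Proof.
move=> m2 br; rewrite /cg_shift (zeck_shift_rec m2 br).
case: eqP => [->|ne]; first by rewrite goldenA_fib // subnn /=; lia.
by rewrite (@goldenA_rec m) //; lia.
Qed.

(** If F_{2m+2} is the largest Fibonacci number up to the sum, its even index brings no correction.
    Otherwise F_{2m+3} is, and peeling it off the sum and F_{2m+1} off [y] leaves equal remainders
    with equal corrections. *)
Lemma cg_shift_add m y : y < fib m.*2.+2 ->
  cg_shift (y + fib m.*2.+2) = fib m.*2.+3 + cg_shift y.
Proof.
move=> lt_y; have f3 := fibSS m.*2.+1; have f4 := fibSS m.*2.+2.
have f2 := fibSS m.*2.
case: (ltnP (y + fib m.*2.+2) (fib m.*2.+3)) => le.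
  rewrite (@cg_shift_rec m.*2.+2) ?addnK //; last by lia.
  by rewrite /= odd_double muln0 addn0.
rewrite (@cg_shift_rec m.*2.+3) //; last by lia.
case: m lt_y le f2 f3 f4 => [|m] lt_y le f2 f3 f4; first by move: lt_y le => /=; lia.
rewrite [in RHS](@cg_shift_rec m.+1.*2.+1) //; last by lia.
rewrite f4 f3.
have -> : y + fib m.+1.*2.+2 - (fib m.+1.*2.+2 + fib m.+1.*2.+1) =
  y - fib m.+1.*2.+1 by lia.
have -> : (y + fib m.+1.*2.+2 == fib m.+1.*2.+2 + fib m.+1.*2.+1) =
  (y == fib m.+1.*2.+1) by lia.
by rewrite /= odd_double /=; lia.
Qed.

(** For m > 0, 2F_{2m+2} = F_{2m+3} + F_{2m}. Peeling off F_{2m+3} leaves y + F_{2m}: this is a case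
    of [cg_shift_add] if y < F_{2m}, and of the induction hypothesis otherwise. *)
Lemma cg_shift_add2 m y : y < fib m.*2.+1 ->
  cg_shift (y + 2 * fib m.*2.+2) = 2 * fib m.*2.+3 + cg_shift y.
Proof.
elim: m y => [|m IH] y lt_y.
  have -> : y = 0 by move: lt_y => /=; lia.
  by [].
rewrite doubleS in lt_y *.
have f5 := fibSS m.*2.+3; have f4 := fibSS m.*2.+2; have f3 := fibSS m.*2.+1.
have f6 := fibSS m.*2.+4; have f2 := fibSS m.*2; have p := fib_gt0 m.*2.+1.
rewrite (@cg_shift_rec m.*2.+4.+1) //; last by lia.
(* No correction arises: the remainder is at least F_{2m+2} > 0. *)
have -> : (y + 2 * fib m.*2.+4 == fib m.*2.+4.+1) = false by lia.
have -> : y + 2 * fib m.*2.+4 - fib m.*2.+4.+1 = y + fib m.*2.+2 by lia.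
case: (ltnP y (fib m.*2.+2)) => le; first by rewrite cg_shift_add //; lia.
have -> : y + fib m.*2.+2 = (y - fib m.*2.+2) + 2 * fib m.*2.+2 by lia.
rewrite IH; last by lia.
rewrite -[in RHS](subnK le) cg_shift_add; lia.
Qed.

(** * Chung-Graham digits: size, uniqueness, existence *)

Definition cg_digits (c : nat -> nat) : Prop :=
  (forall i, 1 <= i -> c i <= 2) /\
  (forall i1 i2, 1 <= i1 -> i1 < i2 -> c i1 = 2 -> c i2 = 2 ->
     exists j, i1 < j < i2 /\ c j = 0).

(* The digits below [N] may be followed by a digit 2 at [N]. *)
Definition cg_open (c : nat -> nat) (N : nat) : Prop :=
  forall i, 1 <= i < N -> c i = 2 -> exists j, i < j < N /\ c j = 0.

Lemma cg_digits_open c N : cg_digits c -> 1 <= N -> c N = 2 -> cg_open c N.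
Proof. by move=> [_ c2] N1 cN i lt_i ci; apply: c2 => //; lia. Qed.

Lemma cg_openS c N : 1 <= N -> cg_open c N.+1 -> c N != 0 ->
  c N <> 2 /\ cg_open c N.
Proof.
move=> N1 op cN; split=> [/(op N)|i lt_i /(op i)]; first by case; lia.
case=> [|j [lt_j cj]]; first by lia.
exists j; split=> //; case: (eqVneq j N) cj => [->|ne _]; last by lia.
by move/eqP: cN.
Qed.

(** The two bounds feed each other. Below a top digit 2 the digits are open, giving 2F_{2N+2} +
    F_{2N+1} = F_{2N+4}; with a top digit 1, openness passes down, giving F_{2N+2} + F_{2N+1} =
    F_{2N+3}. *)
Lemma cg_sum_lt c N : cg_digits c ->
  \sum_(1 <= i < N.+1) c i * fib (2 * i) < fib N.*2.+2 /\
  (cg_open c N.+1 -> \sum_(1 <= i < N.+1) c i * fib (2 * i) < fib N.*2.+1).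
Proof.
move=> cc; elim: N => [|N [IH1 IH2]]; first by rewrite !big_geq.
rewrite sum_nat_recr // mul2n doubleS.
have f3 := fibSS N.*2.+1; have f4 := fibSS N.*2.+2.
have := cc.1 N.+1 isT; have o2 := @cg_digits_open c N.+1 cc isT.
case cN: (c N.+1) o2 => [|[|[|//]]] o2 _.
- by split=> [|_]; lia.
- split=> [|op]; first by lia.
  by have [|_ /IH2] := cg_openS (ltn0Sn N) op; [rewrite cN | lia].
- split=> [|op]; first by have := IH2 (o2 erefl); lia.
  by have [|] := cg_openS (ltn0Sn N) op; rewrite cN.
Qed.

(** The digits below N+1 sum to less than F_{2N+2}, so the top digit is the quotient of the sum by
    F_{2N+2}. *)
Lemma cg_digits_uniq c d N : cg_digits c -> cg_digits d ->
  \sum_(1 <= i < N) c i * fib (2 * i) = \sum_(1 <= i < N) d i * fib (2 * i) ->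
  forall i, 1 <= i < N -> c i = d i.
Proof.
move=> cc cd; elim: N => [|[|N] IH]; [by lia|by lia|].
rewrite !(@sum_nat_recr _ _ N.+1) //.
have [uc _] := cg_sum_lt N cc; have [ud _] := cg_sum_lt N cd.
rewrite mul2n doubleS => e i.
have e' : c N.+1 = d N.+1.
  have := cc.1 N.+1 isT; have := cd.1 N.+1 isT.
  by case: (c N.+1) e => [|[|[|//]]]; case: (d N.+1) => [|[|[|//]]]; lia.
case: (eqVneq i N.+1) => [->//|ne] lt_i; apply: IH; last by lia.
by move: e; rewrite e'; lia.
Qed.

Lemma chung_graham_uniq c d n : chung_graham c n -> chung_graham d n ->
  forall i, 1 <= i -> c i = d i.
Proof.
move=> [c1 c2 [N [cN cn]]] [d1 d2 [M [dM dn]]] i i1.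
pose L := maxn i.+1 (maxn N M).
apply: (@cg_digits_uniq c d L) => //; last by rewrite /L; lia.
rewrite (@big_nat_stable _ 1 N); first last.
- by move=> j j2 jN; rewrite cN.
- by rewrite /L; lia.
rewrite -cn [RHS](@big_nat_stable _ 1 M) //; first by rewrite /L; lia.
by move=> j j2 jM; rewrite dM.
Qed.

(** The third conclusion tells when a 2 may still follow: a new 0 separates it from earlier 2s, and
    a new 1 preserves openness. *)
Lemma cg_digits_extend c N d : cg_digits c -> (forall i, N < i -> c i = 0) ->
  d <= 2 -> (d = 2 -> cg_open c N.+1) ->
  let c' i := if i == N.+1 then d else c i in
  [/\ cg_digits c', forall i, N.+1 < i -> c' i = 0,
      d = 0 \/ (d = 1 /\ cg_open c N.+1) -> cg_open c' N.+2 &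
      \sum_(1 <= i < N.+2) c' i * fib (2 * i) =
      \sum_(1 <= i < N.+1) c i * fib (2 * i) + d * fib N.*2.+2].
Proof.
move=> [c1 c2] c0 d2 dop c'.
have c'E i : i < N.+1 -> c' i = c i by rewrite /c'; case: eqP => //; lia.
have c'0 i : N.+1 < i -> c' i = 0.
  by move=> lt_i; rewrite /c'; case: eqP => [|_]; [lia | apply: c0; lia].
split=> //.
- split=> [i i1|i1 i2 h1 h2]; first by rewrite /c'; case: eqP => // _; apply: c1.
  case: (ltngtP i2 N.+1) => [lt|gt|e]; last first.
  + rewrite c'E; last by lia.
    rewrite e {1}/c' eqxx => ci di.
    have [|j [lt_j cj]] := dop di i1 _ ci; first by lia.
    by exists j; rewrite c'E //; lia.
  + by rewrite (c'0 i2).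
  + rewrite !c'E; [|by lia|by lia] => ci ci'.
    have [j [lt_j cj]] := c2 _ _ h1 h2 ci ci'.
    by exists j; rewrite c'E //; lia.
- move=> dd i lt_i c'i.
  case: dd => [d0|[d1 op]].
    exists N.+1; rewrite /c' eqxx; split=> //.
    by case: (eqVneq i N.+1) c'i => [->|]; [rewrite /c' eqxx d0 | lia].
  have iN : i < N.+1.
    by case: (eqVneq i N.+1) c'i => [->|]; [rewrite /c' eqxx d1 | lia].
  rewrite c'E // in c'i; have [|j [lt_j cj]] := op i _ c'i; first by lia.
  by exists j; rewrite c'E //; lia.
- rewrite sum_nat_recr // {2}/c' eqxx mul2n doubleS; congr (_ + _).
  by apply: eq_big_nat => i lt_i; rewrite c'E //; lia.
Qed.

(** Greedy choice of the top digit; the two ranges for [n] are the two bounds of [cg_sum_lt]. After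
    a top digit 2 the remainder is below F_{2N+1}, so open digits exist for it. *)
Lemma chung_graham_exists n : exists c, chung_graham c n.
Proof.
suff H N : (forall n, n < fib N.*2.+2 -> exists c, [/\ cg_digits c,
      forall i, N < i -> c i = 0 & n = \sum_(1 <= i < N.+1) c i * fib (2 * i)]) /\
    (forall n, n < fib N.*2.+1 -> exists c, [/\ cg_digits c,
      forall i, N < i -> c i = 0, n = \sum_(1 <= i < N.+1) c i * fib (2 * i) &
      cg_open c N.+1]).
  have [|c [[c1 c2] c0 ->]] := (H n).1 n.
    by apply: leq_trans (ltn_fib_add2 n) (leq_fib _); lia.
  by exists c; split=> //; exists n.+1; split=> // i _; apply: c0.
elim: N => [|N [IH1 IH2]].
  split=> {}n lt_n; have -> : n = 0 by (move: lt_n => /=; lia).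
  - by exists (fun=> 0); split; rewrite ?big_geq.
  - by exists (fun=> 0); split; rewrite ?big_geq.
have f3 := fibSS N.*2.+1; have f4 := fibSS N.*2.+2; rewrite doubleS.
split=> {}n lt_n.
- case: (ltnP n (fib N.*2.+2)) => h1.
    have [c [cc c0 cn]] := IH1 _ h1.
    have [//|//|? ? _ s] := @cg_digits_extend c N 0 cc c0.
    by eexists; split; [eassumption|eassumption|rewrite s; lia].
  case: (ltnP n (2 * fib N.*2.+2)) => h2.
    have [|c [cc c0 cn]] := IH1 (n - fib N.*2.+2); first by lia.
    have [//|//|? ? _ s] := @cg_digits_extend c N 1 cc c0.
    by eexists; split; [eassumption|eassumption|rewrite s; lia].
  have [|c [cc c0 cn op]] := IH2 (n - 2 * fib N.*2.+2); first by lia.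
  have [//|//|? ? _ s] := @cg_digits_extend c N 2 cc c0.
  by eexists; split; [eassumption|eassumption|rewrite s; lia].
- case: (ltnP n (fib N.*2.+2)) => h1.
    have [c [cc c0 cn]] := IH1 _ h1.
    have [//|//|? ? o s] := @cg_digits_extend c N 0 cc c0.
    by eexists; split; [eassumption|eassumption|rewrite s; lia|apply: o; left].
  have [|c [cc c0 cn op]] := IH2 (n - fib N.*2.+2); first by lia.
  have [//|//|? ? o s] := @cg_digits_extend c N 1 cc c0.
  by eexists; split; [eassumption|eassumption|rewrite s; lia|apply: o; right].
Qed.

(** The bounds of [cg_sum_lt] are what [cg_shift_add] and [cg_shift_add2] require for adding a top
    digit 1 or 2. *)
Lemma cg_shift_sum c N : cg_digits c ->
  cg_shift (\sum_(1 <= i < N.+1) c i * fib (2 * i)) =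
  \sum_(1 <= i < N.+1) c i * fib (2 * i).+1.
Proof.
move=> cc; elim: N => [|N IH]; first by rewrite !big_geq.
rewrite !(@sum_nat_recr _ _ N.+1) // mul2n doubleS.
have [lt1 lt2] := cg_sum_lt N cc.
have := cc.1 N.+1 isT; have o2 := @cg_digits_open c N.+1 cc isT.
case cN: (c N.+1) o2 => [|[|[|//]]] o2 _; first by rewrite !addn0.
  by rewrite !mul1n cg_shift_add // IH addnC.
by rewrite cg_shift_add2 ?IH 1?addnC //; apply: lt2; apply: o2.
Qed.

(** * Raising all indices of a decomposition *)

Local Arguments fib : simpl never.

(** By [fib_add], a digit sum and its shift by one determine all higher shifts. *)
Lemma sum_fib_add (d f : nat -> nat) m N s :
  \sum_(m <= i < N) d i * fib (f i + s.+1) =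
  fib s.+1 * (\sum_(m <= i < N) d i * fib (f i).+1) +
  fib s * (\sum_(m <= i < N) d i * fib (f i)).
Proof.
rewrite !big_distrr -big_split /=; apply: eq_bigr => i _.
by rewrite fib_add; lia.
Qed.

(* The number q(j) of the header, for [s.+1 = 2 * k]. *)
Definition zeck_raise s j := fib s.+1 * (zeck_shift j).+1 + fib s * j.

(** [zeck_shift] is used as weakly increasing only; strictness comes from the term F_s j. *)
Lemma zeck_raise_lt s i j : 0 < s -> i < j -> zeck_raise s i < zeck_raise s j.
Proof.
move=> s0 ij; rewrite /zeck_raise -addnS; apply: leq_add.
  by rewrite leq_mul2l ltnS zeck_shift_mono ?orbT // ltnW.
by rewrite ltn_mul2l ij andbT -(prednK s0) fib_gt0.
Qed.

Lemma zeckendorf_raise s j : 1 <= s -> exists a,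
  [/\ zeckendorf a (zeck_raise s j), a s.+1 = 1 & forall i, i <= s -> a i = 0].
Proof.
move=> s1; have [a [a1 a2 [N [aN jE]]]] := zeckendorf_exists j.
(* The digits of [j] start at index 2, hence land at [s.+3] or above and leave a 0 at [s.+2]. *)
pose b i := if i == s.+1 then 1 else if s.+3 <= i then a (i - s.+1) else 0.
exists b; split; last 2 first.
- by rewrite /b eqxx.
- by move=> i le; rewrite /b; case: eqP; [lia|case: ifP => //; lia].
split.
- by move=> i _; rewrite /b; case: ifP => // _; case: ifP => // h; apply: a1; lia.
- move=> i i2; rewrite /b; case: (eqVneq i s.+1) => [->|ne].
    by rewrite gtn_eqF // ltnn; case.
  case: (leqP s.+3 i) => h; last by case.
  rewrite gtn_eqF; last by lia.
  rewrite (leqW h) subSn; last by lia.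
  by apply: a2; lia.
- exists (s.+1 + maxn 2 N); split=> [i i2 le|].
    rewrite /b gtn_eqF; last by lia.
    by case: ifP => // h; apply: aN; lia.
  rewrite (@big_cat_nat _ _ _ s.+1) /=; [|by lia|by lia].
  rewrite big_nat_cond big1 ?add0n; last first.
    move=> i /andP[/andP[_ lt] _]; rewrite /b.
    by case: eqP; [lia|case: ifP => //; lia].
  rewrite big_ltn; last by lia.
  rewrite big_ltn; last by lia.
  rewrite {1 2}/b eqxx gtn_eqF // ltnn mul0n add0n mul1n /zeck_raise mulnS.
  rewrite -addnA; congr (_ + _).
  have -> : s.+3 = 2 + s.+1 by lia.
  rewrite addnC [s.+1 + _]addnC big_addn addnK.
  rewrite -(@big_nat_stable _ 2 N (maxn 2 N)) in jE; last 2 first.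
  - by lia.
  - by move=> i i2 iN; rewrite aN.
  rewrite {1 2}jE zeck_shift_sum // addnC -(sum_fib_add a id).
  apply: eq_big_nat => i lt_i; rewrite /b gtn_eqF; last by lia.
  by rewrite ifT ?addnK //; lia.
Qed.

(** Lowering the digits from [s.+3] on by [s.+1] yields [j]; the digit at [s.+2] vanishes beside the
    1 at [s.+1]. *)
Lemma zeckendorf_min_raise s a n : 1 <= s -> zeckendorf a n -> a s.+1 = 1 ->
  (forall i, 2 <= i <= s -> a i = 0) -> exists j, n = zeck_raise s j.
Proof.
move=> s1 [a1 a2 [N [aN nE]]] as1 a0.
pose b i := a (i + s.+1).
have zb : zeck_digits b.
  split=> i i2; first by apply: a1; lia.
  by apply: a2; lia.
exists (\sum_(2 <= i < N) b i * fib i).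
rewrite /zeck_raise zeck_shift_sum // mulnS -addnA -(sum_fib_add b id).
rewrite nE -(@big_nat_stable _ 2 N (N + s.+3)); last 2 first.
- by lia.
- by move=> i i2 iN; rewrite aN.
rewrite (@big_cat_nat _ _ _ s.+1) /=; [|by lia|by lia].
rewrite big_nat_cond big1 ?add0n; last first.
  by move=> i /andP[/andP[h1 h2] _]; rewrite a0 //; lia.
rewrite big_ltn; last by lia.
rewrite big_ltn; last by lia.
have -> : a s.+2 = 0.
  have := a1 s.+2 isT; case E: (a s.+2) => [|[|//]] // _.
  by case: (a2 s.+1).
rewrite as1 mul1n mul0n add0n; congr (_ + _).
have -> : s.+3 = 2 + s.+1 by lia.
rewrite big_addn (@big_nat_stable _ 2 N) //; first by lia.
by move=> i i2 iN; rewrite aN //; lia.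
Qed.

Lemma smallest_summand_setE s n : 1 <= s ->
  smallest_summand_set s.+1 n <-> exists j, n = zeck_raise s j.
Proof.
move=> s1; split=> [[n0 ln]|[j ->]].
  have [a za] := zeckendorf_exists n; case: (za) => a1 a2 [N [aN nE]].
  have [i0 /andP[i02 ai0] min_i0] :
      exists2 i, (2 <= i) && (a i != 0) &
        forall i', (2 <= i') && (a i' != 0) -> i <= i'.
    have ex : exists i, (2 <= i) && (a i != 0).
      apply: contrapT => nex; move: n0; rewrite nE big_nat_cond big1 // => i.
      move=> /andP[/andP[i2 _] _]; case: (eqVneq (a i) 0) => [->//|ai].
      by case: nex; exists i; rewrite i2.
    by case: (ex_minnP ex) => i h1 h2; exists i.
  have l0 : least (Zeck n) = fib i0.
    apply: leastE; first by exists a; split=> //; exists i0; split=> //; apply/eqP.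
    move=> _ [b [zb [i [i2 bi ->]]]]; apply: leq_fib; apply: min_i0.
    by rewrite i2 (zeckendorf_uniq za zb) //; apply/eqP.
  (* From index 2 on, a Fibonacci number determines its index. *)
  have e : i0 = s.+1 by apply: fib_inj => //; rewrite -l0.
  rewrite {}e in ai0 min_i0 i02; apply: (zeckendorf_min_raise (a := a)) => //.
    by have := a1 s.+1 i02; case: (a s.+1) ai0 => [|[|]].
  move=> i lt_i; case: (eqVneq (a i) 0) => // ai.
  by have := min_i0 i; rewrite ai; lia.
have [a [za a1 a0]] := zeckendorf_raise j s1.
split.
  by rewrite /zeck_raise mulnS; have := fib_gt0 s; lia.
apply: leastE; first by exists a; split=> //; exists s.+1; rewrite a1.
move=> _ [b [zb [i [i2 bi ->]]]]; apply: leq_fib.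
case: (leqP i s) => // le; case: bi.
by rewrite -(zeckendorf_uniq za zb) // a0.
Qed.

(** The digits of [j] move up by [k]. The new digit at [k] is at most 1, so it adds no pair of 2s to
    separate. *)
Lemma chung_graham_raise k j : 1 <= k -> exists c,
  [/\ chung_graham c (zeck_raise (2 * k).-1 j),
      c k = 1 - goldenA j & forall i, i < k -> c i = 0].
Proof.
move=> k1; have [c [c1 c2 [N [cN jE]]]] := chung_graham_exists j.
have gA : goldenA j <= 1 by rewrite /goldenA; case: j {jE} => // j; case: golden_string.
pose b i := if i == k then 1 - goldenA j else if k < i then c (i - k) else 0.
have bE i : 1 <= i -> b (i + k) = c i.
  by move=> i1; rewrite /b gtn_eqF ?addnK ?ifT //; lia.
have b2 i : b i = 2 -> k < i.
  by rewrite /b; case: eqP => _; [lia|case: ifP].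
exists b; split; last 2 first.
- by rewrite /b eqxx.
- by move=> i lt; rewrite /b; case: eqP; [lia|case: ifP => //; lia].
split.
- move=> i _; rewrite /b; case: ifP => _; first by lia.
  by case: ifP => // h; apply: c1; lia.
- move=> i1 i2 _ lt bi1 bi2; have k1' := b2 _ bi1.
  have e1 : i1 = i1 - k + k by lia.
  have e2 : i2 = i2 - k + k by lia.
  rewrite e1 bE in bi1; last by lia.
  rewrite e2 bE in bi2; last by lia.
  have [| |i [lt_i ci]] := c2 _ _ _ _ bi1 bi2; [by lia|by lia|].
  by exists (i + k); rewrite bE //; lia.
- exists (k + N.+1); split=> [i i1 le|].
    rewrite (_ : i = i - k + k) ?bE ?cN //; lia.
  rewrite (@big_cat_nat _ _ _ k) /=; [|by lia|by lia].
  rewrite big_nat_cond big1 ?add0n; last first.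
    move=> i /andP[/andP[_ lt] _]; rewrite /b.
    by case: eqP; [lia|case: ifP => //; lia].
  rewrite big_ltn; last by lia.
  rewrite {1}/b eqxx -[k.+1]add1n [k + N.+1]addnC big_addn addnK.
  rewrite -(@big_nat_stable _ 1 N N.+1) in jE; last 2 first.
  - by lia.
  - by move=> i i1 iN; rewrite cN.
  have -> : \sum_(1 <= i < N.+1) b (i + k) * fib (2 * (i + k)) =
      \sum_(1 <= i < N.+1) c i * fib (2 * i + (2 * k).-1.+1).
    apply: eq_big_nat => i lt_i; rewrite bE; last by lia.
    by congr (_ * fib _); lia.
  rewrite sum_fib_add -jE -cg_shift_sum // -jE /zeck_raise /cg_shift.
  rewrite prednK; last by lia.
  (* With [goldenA j] at most 1 the truncated difference is exact: (1 - [goldenA j]) + (z +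
     [goldenA j]) = 1 + z. *)
  by case: (goldenA j) gA => [|[|]] //; lia.
Qed.

(** * Chung-Graham summands of the elements of A_{2k} *)

Theorem theorem1p2 (k : nat) (hk : 1 <= k) :
  let p := nth_smallest (smallest_summand_set (2 * k)) in
  (forall j : nat, 2 <= j ->
     (CG (p j) (fib (2 * k)) <-> golden_string (j - 1) = letB)) /\
  (forall j : nat, 1 <= j -> fib (2 * k) <= least (CG (p j))).
Proof.
move=> p; pose s := (2 * k).-1.
have s1 : 1 <= s by rewrite /s; lia.
have sE : s.+1 = 2 * k by rewrite /s; lia.
have pE j : p j.+1 = zeck_raise s j.
  rewrite /p -sE; apply: nth_smallest_enum => [i i'|n].
    exact: zeck_raise_lt.
  exact: smallest_summand_setE.
split=> [[|[|j]] // _|[|j] // _].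
  (* The index is now [j.+2], so the letter sits at [j.+1] > 0, where [goldenA] is not the
     conventional value. *)
  rewrite pE subn1; have [c [cc ck c0]] := chung_graham_raise j.+1 hk.
  have -> : CG (zeck_raise s j.+1) (fib (2 * k)) <-> c k <> 0.
    split=> [[d [cd [i [i1 di /fib_inj e]]]]|ck0].
      have -> : k = i by (move: e; lia).
      by rewrite (chung_graham_uniq cc cd).
    by exists c; split=> //; exists k.
  by rewrite ck /goldenA /=; case: golden_string.
rewrite pE; have [c [cc ck c0]] := chung_graham_raise j hk.
(* For an empty set [least] would be the default 0, and the bound would fail. *)
have ne : exists f, CG (zeck_raise s j) f.
  apply: contrapT => nex; case: (cc) => _ _ [N [_ e]].
  have : zeck_raise s j = 0.
    rewrite /s e big_nat_cond big1 // => i /andP[/andP[i1 _] _].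
    case: (eqVneq (c i) 0) => [->//|ci]; case: nex.
    by exists (fib (2 * i)), c; split=> //; exists i; split=> //; apply/eqP.
  by rewrite /zeck_raise mulnS; have := fib_gt0 s; lia.
have [f CGf min_f] : exists2 f, CG (zeck_raise s j) f &
    forall g, CG (zeck_raise s j) g -> f <= g.
  have ex : exists f, `[< CG (zeck_raise s j) f >].
    by case: ne => f h; exists f; apply/asboolP.
  by case: (ex_minnP ex) => f /asboolP h1 h2; exists f => // g /asboolP/h2.
rewrite (leastE CGf min_f); case: CGf => d [cd [i [i1 di ->]]].
apply: leq_fib; case: (leqP k i) => [|lt]; first by lia.
by case: di; rewrite -(chung_graham_uniq cc cd) // c0.
Qed.
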